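(* Let $\theta$ be a regular uncountable cardinal and suppose that $\square(\theta)$ holds. Then there is a zero-dimensional, first countable, $<\!\theta$-collectionwise Hausdorff topological space that is not weakly $\theta$-collectionwise Hausdorff.
   Context: $\square(\theta)$ asserts the existence of a sequence $\{C_\alpha:\alpha<\theta\}$ such that: (i) each $C_\alpha$ is a club subset of $\alpha$; (ii) if $\alpha$ is a limit point of $C_\beta$ then $C_\alpha=C_\beta\cap\alpha$; (iii) there is no club $C\subseteq\theta$ such that $C_\alpha=C\cap\alpha$ for every limit point $\alpha$ of $C$. A subset $A$ of a space $X$ can be separated if there are pairwise disjoint open sets $U_x\ni x$ ($x\in A$). $X$ is $<\!\theta$-collectionwise Hausdorff if every closed discrete subset of size $<\theta$ can be separated. $A$ is weakly separated if some subset of $A$ of size $|A|$ can be separated; $X$ is weakly $\theta$-collectionwise Hausdorff if every closed discrete subset of size $\theta$ is weakly separated. *)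

(* Defs.v *)
From mathcomp Require Import all_boot all_order.
From mathcomp Require Import all_classical wochoice topology.

Set Implicit Arguments.
Unset Strict Implicit.
Unset Printing Implicit Defensive.

Import Order.TTheory.
Local Open Scope classical_set_scope.
Local Open Scope card_scope.

Definition card_lt (I J : Type) (A : set I) (B : set J) : Prop :=
  A #<= B /\ ~ (B #<= A).

(* A cardinal theta is given by a well-ordered type T standing for the set of
   ordinals below theta; an ordinal a < theta is a point a : T, identified with
   the initial segment below a. *)
Section Ordinals.
Context (d : Order.disp_t) (T : orderType d).
Implicit Types (a b x y : T) (S C A : set T).

Definition below a : set T := [set x | (x < a)%O].

(* The non-strict inequality makes this correct also below successor ordinals:
   a subset of b + 1 is cofinal in it iff it contains b. *)
Definition cofinal_in S C : Prop :=
  C `<=` S /\ forall x, S x -> exists2 y, C y & (x <= y)%O.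

(* The first clause excludes a = 0. *)
Definition ord_limit_point C a : Prop :=
  below a !=set0 /\
  forall x, (x < a)%O -> exists2 y, C y & (x < y < a)%O.

(* To be used with S = below a (club subsets of the ordinal a) or S = setT
   (club subsets of theta). *)
Definition club_in S C : Prop :=
  cofinal_in S C /\ forall a, S a -> ord_limit_point C a -> C a.

Definition is_cardinal : Prop :=
  well_order (<=%O : rel T) /\ forall a, card_lt (below a) [set: T].

Definition regular_uncountable_cardinal : Prop :=
  [/\ is_cardinal,
      ~ countable [set: T] &
      forall A, cofinal_in [set: T] A -> ~ card_lt A [set: T]].

Definition square_sequence (C : T -> set T) : Prop :=
  [/\ forall a, club_in (below a) (C a),
      forall a b, ord_limit_point (C b) a -> C a = C b `&` below a &
      ~ exists D : set T, club_in [set: T] D /\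
          forall a, ord_limit_point D a -> C a = D `&` below a].

Definition square : Prop := exists C : T -> set T, square_sequence C.

End Ordinals.

Section Spaces.
Context (X : topologicalType).
Implicit Types A B : set X.

(* The library's [zero_dimensional] only asks that points be separated by
   clopen sets, which is weaker than having a clopen base.  T1 is part of the
   usual definition; with a clopen base it yields Hausdorff. *)
Definition zero_dimensional_space : Prop :=
  accessible_space X /\ exists2 B : set (set X), B `<=` clopen & basis B.

Definition first_countable : Prop :=
  forall x : X, exists2 B : set (set X),
    countable B & nbhs x = filter_from B id.

Definition closed_discrete A : Prop := closed A /\ A `<=` isolated A.

Definition can_be_separated A : Prop :=
  exists U : X -> set X,
    (forall x, A x -> open (U x) /\ U x x) /\ trivIset A U.

Definition weakly_separated A : Prop :=
  exists B : set X, [/\ B `<=` A, B #= A & can_be_separated B].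

(* K is any set whose cardinality is the cardinal parameter. *)
Definition lt_collectionwise_hausdorff (I : Type) (K : set I) : Prop :=
  forall A, closed_discrete A -> card_lt A K -> can_be_separated A.

Definition weakly_collectionwise_hausdorff (I : Type) (K : set I) : Prop :=
  forall A, closed_discrete A -> A #= K -> weakly_separated A.

End Spaces.

Arguments regular_uncountable_cardinal {d} T.
Arguments is_cardinal {d} T.
Arguments square {d} T.

(* Main.v *)
(* Let f(a,b) be the length of the walk from b down to a along the square
   sequence.  The space consists of theta together with isolated points (a,b); a
   basic neighbourhood of a is {a} together with the pairs involving a at which
   f >= n.  A set A of non-isolated points is then separated iff some g : A -> omega
   satisfies f(a,b) < max(g(a), g(b)) on A.  Walk lengths are coherent, i.e. f(.,a)
   and f(.,c) differ boundedly below a, and this provides such a g below every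
   c < theta.  On the other hand, a separated set of size theta would contain a
   subset of size theta on which g is constant, hence f bounded; this is
   impossible since it would give a club threading the square sequence. *)

Require Import Defs.
From HB Require Import structures.
From mathcomp Require Import all_boot all_order.
From mathcomp Require Import all_classical wochoice topology.
From mathcomp Require Import zify.

Set Implicit Arguments.
Unset Strict Implicit.
Unset Printing Implicit Defensive.

Import Order.TTheory.
Local Open Scope classical_set_scope.
Local Open Scope card_scope.

(* When [f] vanishes off the increasing pairs, the other pairs are harmless extra
   isolated points. *)
Definition pair_space (T : choiceType) (f : T -> T -> nat) : Type :=
  (T + T * T)%type.

(** * The space of points and pairs, and separation as domination *)

Section PairSpace.
Context (T : choiceType) (f : T -> T -> nat).
Local Notation X := (pair_space f).
Implicit Types (a b : T) (A O : set X) (x : X).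

Definition pt a : X := inl a.
Definition pair_nbhs n a : set X := [set x | match x with
  | inl b => b = a
  | inr (p, q) => (a = p \/ a = q) /\ n <= f p q
  end].

Definition pair_open O := forall a, O (pt a) -> exists n, pair_nbhs n a `<=` O.

Lemma pair_nbhsS m n a : m <= n -> pair_nbhs n a `<=` pair_nbhs m a.
Proof. by move=> mn [//|[p q]] [apq /(leq_trans mn)]. Qed.

Lemma pair_openT : pair_open setT.
Proof. by move=> a _; exists 0. Qed.

Lemma pair_openI : setI_closed pair_open.
Proof.
move=> O O' oO oO' a [/oO[m mO] /oO'[n nO']]; exists (maxn m n) => x axm.
by split; [apply: mO | apply: nO']; apply: pair_nbhsS axm; rewrite (leq_maxl, leq_maxr).
Qed.

Lemma pair_open_bigU (I : Type) (F : I -> set X) :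
  (forall i, pair_open (F i)) -> pair_open (\bigcup_i F i).
Proof.
by move=> oF a [i _ /(oF i)[n nF]]; exists n => x /nF; exists i.
Qed.

HB.instance Definition _ := Choice.on X.
HB.instance Definition _ :=
  isOpenTopological.Build X pair_openT pair_openI pair_open_bigU.

Lemma open_pairE O : open O = pair_open O.
Proof. by []. Qed.

Lemma open_pair_nbhs n a : open (pair_nbhs n a).
Proof. by move=> b ->; exists n. Qed.

Lemma open_set1_inr p : open ([set inr p] : set X).
Proof. by []. Qed.

(** For [b <> a], only [(a, b)] and [(b, a)] can lie in neighbourhoods of both points, and a level
    above both values of [f] excludes them. *)
Lemma clopen_pair_nbhs n a : clopen (pair_nbhs n a).
Proof.
split; first exact: open_pair_nbhs.
rewrite -openC open_pairE => b /= /eqP ab.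
exists (maxn (f a b) (f b a)).+1 => -[c -> /=|]; first exact/eqP.
move=> [p q] /= [bpq fpq] [apq _].
move: fpq ab; rewrite gtn_max => /andP[].
by case: apq => ->; case: bpq => ->; rewrite ?eqxx ?ltnn ?andbF.
Qed.

Lemma clopen_set1_inr p : clopen ([set inr p] : set X).
Proof.
split; first exact: open_set1_inr.
case: p => p q; rewrite -openC open_pairE => b _.
by exists (f p q).+1 => -[c _ //|[p' q'] /= [_]] + [pp qq]; rewrite pp qq ltnn.
Qed.

Definition pair_base : X -> nat -> set X := fun x n =>
  match x with inl a => pair_nbhs n a | inr p => [set inr p] end.

Lemma pair_base_mem x n : pair_base x n x.
Proof. by case: x. Qed.

Lemma clopen_pair_base x n : clopen (pair_base x n).
Proof. by case: x => ? /=; [exact: clopen_pair_nbhs|exact: clopen_set1_inr]. Qed.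

Lemma nbhs_pairE x : nbhs x = filter_from (range (pair_base x)) id.
Proof.
apply/seteqP; split => A.
  rewrite nbhsE => -[O [oO Ox] OA]; case: x Ox => [a /oO[n nO]|p Op].
    by exists (pair_nbhs n a); [exists n|apply: subset_trans OA].
  by exists [set inr p]; [exists 0|move=> _ ->; exact: OA].
move=> [_ [n _ <-] nA]; apply: filterS nA _; apply: open_nbhs_nbhs.
by split; [exact: (clopen_pair_base x n).1|exact: pair_base_mem].
Qed.

Lemma pair_space_first_countable : first_countable X.
Proof.
move=> x; exists (range (pair_base x)); last exact: nbhs_pairE.
exact: card_le_trans (card_image_le _ _) (countableP _).
Qed.

Lemma pair_space_zero_dimensional : zero_dimensional_space X.
Proof.
split=> [x y xy|].
  case: x y xy => [a|p] y xy; last first.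
    by exists [set inr p]; rewrite !in_setE; split => //= yp; rewrite yp eqxx in xy.
  case: y xy => [b ab|[p q] _].
    exists (pair_nbhs 0 a); rewrite !in_setE; split => //=; first exact: open_pair_nbhs.
    by move=> ba; rewrite ba eqxx in ab.
  exists (pair_nbhs (f p q).+1 a); rewrite !in_setE; split => //=.
    exact: open_pair_nbhs.
  by rewrite ltnn => -[].
exists [set pair_base x n | x in setT & n in setT].
  by move=> _ [x _ [n _ <-]]; exact: clopen_pair_base.
split=> [_ [x _ [n _ <-]]|x A]; first exact: (clopen_pair_base x n).1.
rewrite nbhs_pairE => -[_ [n _ <-] nA]; exists (pair_base x n) => //.
by split; [exists x => //; exists n|exact: pair_base_mem].
Qed.

Lemma closed_discrete_range_pt : closed_discrete (range pt).
Proof.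
split.
  by rewrite -openC open_pairE => a []; exists a.
move=> _ [a _ <-]; split; first by rewrite in_setE; exists a.
exists (pair_nbhs 0 a).
  by apply: open_nbhs_nbhs; split => //; exact: open_pair_nbhs.
apply/seteqP; split=> [y [/= + [b _ yb]]|_ ->]; first by rewrite -yb /= => ->.
by split => //; exists a.
Qed.

Definition dominated (A : set T) (g : T -> nat) :=
  forall a b, A a -> A b -> a <> b -> f a b < maxn (g a) (g b).

(** Let [g a] be a level at which the neighbourhood of [a] fits into [U (pt a)]. If [f a b] reached
    both levels, the pair [(a, b)] would lie in two disjoint sets. *)
Lemma can_be_separated_dominated (A : set X) :
  can_be_separated A -> exists g, dominated (pt @^-1` A) g.
Proof.
move=> [U [oU tU]].
have /choice[g gP] a : exists n, A (pt a) -> pair_nbhs n a `<=` U (pt a).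
  case: (pselect (A (pt a))) => [Aa|]; last by exists 0.
  by have [/(_ a)/[apply][[n]]] := oU _ Aa; exists n.
exists g => a b Aa Ab ab; rewrite ltnNge; apply/negP => gf; apply: ab.
suff [] : pt a = pt b :> X by [].
apply: tU => //; exists (inr (a, b)).
by split; apply: gP => //=; split; [left| |right|];
  rewrite // (leq_trans _ gf) ?leq_maxl ?leq_maxr.
Qed.

Lemma dominated_can_be_separated (A : set X) g :
  closed_discrete A -> dominated (pt @^-1` A) g -> can_be_separated A.
Proof.
move=> [_ iA] gA.
have /choice[n nP] (x : X) : exists n, A x -> pair_base x n `&` A `<=` [set x].
  case: (pselect (A x)) => [/iA[_ [V]]|]; last by exists 0.
  rewrite nbhs_pairE => -[_ [n _ <-] nV VA]; exists n => _ y [/nV ? ?].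
  by rewrite -VA.
(* [A] may also contain isolated points: [g] separates the others from each other, while [n] keeps
   each neighbourhood off the rest of [A]. *)
pose m (x : X) := match x with inl a => maxn (g a) (n x) | inr _ => n x end.
have nm x : pair_base x (m x) `<=` pair_base x (n x).
  by case: x => [a|p] //=; apply: pair_nbhsS; exact: leq_maxr.
exists (fun x => pair_base x (m x)); split.
  by move=> x _; split; [exact: (clopen_pair_base x _).1|exact: pair_base_mem].
move=> x y Ax Ay [z [xz yz]].
have sx p : x = inr p -> z = x by move=> xp; move: xz; rewrite xp.
have sy p : y = inr p -> z = y by move=> xp; move: yz; rewrite xp.
case: x y Ax Ay xz yz sx sy => [a|p] [b|q] Ax Ay xz yz sx sy.
(* A common point must be [(a, b)] or [(b, a)], at which [f] is at least [maxn (g a) (g b)]. *)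
- apply: contrapT => ab.
  case: z xz yz {sx sy} => [c /= ca cb|[p q]]; first by apply: ab; rewrite -ca -cb.
  move=> [apq]; rewrite geq_max => /andP[ga _] [bpq]; rewrite geq_max => /andP[gb _].
  have {}ab : a <> b by move=> ab'; apply: ab; rewrite ab'.
  have := gA _ _ Ax Ay ab; have := gA _ _ Ay Ax (nesym ab).
  case: apq ga gb ab => ->; case: bpq => -> ga gb ab //.
    by move=> _; rewrite ltnNge geq_max ga gb.
  by move=> + _; rewrite ltnNge geq_max ga gb.
- have zy := sy _ erefl; move: xz; rewrite zy => xz.
  by rewrite -(nP _ Ax (inr q)) //; split => //; exact: nm.
- have zx := sx _ erefl; move: yz; rewrite zx => yz.
  by rewrite -(nP _ Ay (inr p)) //; split => //; exact: nm.
- by rewrite -(sx _ erefl) -(sy _ erefl).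
Qed.

Lemma card_pt (B : set T) : (@pt @` B) #= B.
Proof. by apply: inj_card_eq => a b _ _ []. Qed.

Lemma card_preimage_pt A : pt @^-1` A #<= A.
Proof.
by apply: card_ge_preimage => a b _ _ [].
Qed.

End PairSpace.

(** * Minimal walks and the coherence of their lengths *)

Section Walks.
Context (d : Order.disp_t) (T : orderType d).
Hypothesis woT : well_order (<=%O : rel T).
Implicit Types (a b c x y : T) (A : set T).

Lemma well_order_min A : A !=set0 -> exists2 m, A m & forall x, A x -> (m <= x)%O.
Proof.
move=> [x Ax]; have [|m [[Am mA] _]] := woT (A := [pred x | x \in A]).
  by exists x; exact: mem_set.
exists m; first exact: set_mem.
by move=> y Ay; apply: mA; exact: mem_set.
Qed.

Lemma well_order_ind (P : T -> Prop) :
  (forall x, (forall y, (y < x)%O -> P y) -> P x) -> forall x, P x.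
Proof.
move=> IH x; apply: contrapT => nPx.
have [m nPm mP] := @well_order_min [set x | ~ P x] (ex_intro _ x nPx).
apply/nPm/IH => y ym; apply: contrapT => /mP; by rewrite leNgt ym.
Qed.

Variable C : T -> set T.
Hypothesis C_club : forall a, club_in (below a) (C a).

Lemma exists_next b x : exists c, (x < b)%O ->
  [/\ C b c, (x <= c)%O & forall y, C b y -> (x <= y)%O -> (c <= y)%O].
Proof.
case: (ltP x b) => [xb|_]; last by exists x.
have [c [Cc xc] mc] : exists2 m, (C b m /\ (x <= m)%O) &
    forall y, C b y /\ (x <= y)%O -> (m <= y)%O.
  apply: (@well_order_min [set y | C b y /\ (x <= y)%O]).
  by have [y Cy xy] := (C_club b).1.2 _ xb; exists y.
by exists c => _; split => // y Cy xy; apply: mc.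
Qed.

(** The first step of the walk from [b] to [x], namely the least element of [C b] not below [x]. The
    value is arbitrary when [b <= x], where walks have already stopped. *)
Definition next x b : T := projT1 (cid (exists_next b x)).

Lemma nextP x b : (x < b)%O -> [/\ C b (next x b), (x <= next x b)%O &
  forall y, C b y -> (x <= y)%O -> (next x b <= y)%O].
Proof. exact: projT2 (cid (exists_next b x)). Qed.

Lemma next_lt x b : (x < b)%O -> (next x b < b)%O.
Proof. by move=> /nextP[/(C_club b).1.1]. Qed.

Lemma next_unique x b c : (x < b)%O -> C b c -> (x <= c)%O ->
  (forall y, C b y -> (x <= y)%O -> (c <= y)%O) -> next x b = c.
Proof.
move=> /nextP[Cn xn nC] Cc xc cC; apply/le_anti.
by rewrite nC // cC.
Qed.

Lemma exists_walk_length x b : exists n, (iter n (next x) b <= x)%O.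
Proof.
elim/well_order_ind: b => b IH.
case: (leP b x) => [bx|xb]; first by exists 0.
have [n nx] := IH _ (next_lt xb).
by exists n.+1; rewrite iterSr.
Qed.

(* Todorcevic's rho_2: the length of the walk from [b] to [x] along [C]. *)
Definition rho2 x b : nat := ex_minn (exists_walk_length x b).

Lemma rho2_lt x b : (x < b)%O -> rho2 x b = (rho2 x (next x b)).+1.
Proof.
move=> xb; rewrite /rho2; case: ex_minnP => n nx nmin; case: ex_minnP => m mx mmin.
apply/eqP; rewrite eqn_leq nmin ?iterSr //=.
case: n nx {nmin} => [|n]; first by rewrite /= leNgt xb.
by rewrite iterSr => /mmin.
Qed.

(** Some interval [(c, a)] misses [C b], so from any [x] in it the search in [C b] continues to the
    same element as from [a]. *)
Lemma not_limit_next a b : below a !=set0 -> (a < b)%O ->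
  ~ ord_limit_point (C b) a ->
  exists2 c, (c < a)%O & forall x, (c < x < a)%O -> next x b = next a b.
Proof.
move=> a0 ltab nlim.
have [c ca cP] : exists2 c, (c < a)%O & forall y, C b y -> ~~ (c < y < a)%O.
  apply: contrapT => H; apply: nlim; split => // x xa.
  apply: contrapT => H'; apply: H; exists x => // y Cy; apply/negP => xya.
  by apply: H'; exists y.
exists c => // x /andP[cx xa].
have [Cn an nC] := nextP ltab.
apply: next_unique => //; first exact: lt_trans ltab.
  exact: le_trans (ltW xa) an.
move=> y Cy xy; apply: nC => //; rewrite leNgt; apply/negP => ya.
by have := cP _ Cy; rewrite (lt_le_trans cx xy) ya.
Qed.

Hypothesis C_coherent :
  forall a b, ord_limit_point (C b) a -> C a = C b `&` below a.

(** [C a] is an initial segment of [C b] and cofinal in [a], so the search from [x] ends below [a]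
    in both. *)
Lemma limit_next a b x : ord_limit_point (C b) a -> (a <= b)%O -> (x < a)%O ->
  next x b = next x a.
Proof.
move=> lim ab xa; have [] := nextP xa.
rewrite (C_coherent lim) => -[Cn na] xn nC.
apply: next_unique => //; first exact: lt_le_trans ab.
move=> y Cy xy; case: (ltP y a) => [ya|ay]; first exact: nC.
exact/ltW/lt_le_trans/ay.
Qed.

(* Just below [a], the walks from [b] follow a common path that first reaches
   either [a] or some [c] such that [a] is a limit point of [C c], after which
   the walks from [c] and from [a] agree. *)
Lemma rho2_eventual_shift a b : below a !=set0 -> (a <= b)%O ->
  exists k, exists2 c, (c < a)%O &
    forall x, (c < x < a)%O -> rho2 x b = rho2 x a + k.
Proof.
move=> a0; elim/well_order_ind: b => b IH ab.
have [lim|nlim] := pselect (ord_limit_point (C b) a).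
  have [c ca] := a0; exists 0; exists c => // x /andP[_ xa].
  have xb := lt_le_trans xa ab.
  by rewrite addn0 (rho2_lt xa) (rho2_lt xb) (limit_next lim).
case: (ltgtP a b) ab => // [ltab|<-] _; last first.
  have [c ca] := a0; exists 0; exists c => // x _.
  by rewrite addn0.
have [c ca cP] := not_limit_next a0 ltab nlim.
have [_ an _] := nextP ltab.
have [k [c' c'a c'P]] := IH _ (next_lt ltab) an.
exists k.+1; exists (Order.max c c'); first by rewrite gt_max ca.
move=> x /andP[]; rewrite gt_max => /andP[cx c'x] xa.
by rewrite rho2_lt ?(lt_trans xa)// cP ?cx// c'P ?c'x// addnS.
Qed.

Lemma rho2_coherent a b : (a <= b)%O -> exists k, forall x, (x < a)%O ->
  rho2 x a <= rho2 x b + k /\ rho2 x b <= rho2 x a + k.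
Proof.
elim/well_order_ind: a b => a IH b ab.
have [a0|na0] := pselect (below a !=set0); last first.
  by exists 0 => x xa; case: na0; exists x.
have [k [c ca cP]] := rho2_eventual_shift a0 ab.
have [ka kaP] := IH c ca a (ltW ca).
have [kb kbP] := IH c ca b (le_trans (ltW ca) ab).
(* [k] serves the [x] above [c], [ka + kb] those below (comparing through [c]), and the last two
   terms [x = c]. *)
exists (k + ka + kb + rho2 c a + rho2 c b) => x xa.
case: (ltgtP x c) => [xc|cx|->]; last by lia.
  by have := kaP _ xc; have := kbP _ xc; lia.
by rewrite cP ?cx//; lia.
Qed.

Lemma rho2_dominated c : exists g : T -> nat, forall a b, (a < b)%O -> (b < c)%O ->
  rho2 a b < maxn (g a) (g b).
Proof.
have /choice[h hP] b : exists k, (b < c)%O -> forall x, (x < b)%O ->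
    rho2 x b <= rho2 x c + k.
  case: (ltP b c) => [bc|]; last by exists 0.
  by have [k kP] := rho2_coherent (ltW bc); exists k => _ x /kP[].
(* Coherence gives [rho2 a b <= rho2 a c + h b]; doubling absorbs the sum and the successor makes
   the bound strict. *)
exists (fun a => ((maxn (rho2 a c) (h a)).*2).+1) => a b ab bc.
by have := hP _ bc _ ab; lia.
Qed.

(** * Walk lengths are unbounded on unbounded sets *)

Hypothesis countable_bounded :
  forall A, countable A -> exists b, forall x, A x -> (x < b)%O.
Hypothesis C_nontrivial : ~ exists D : set T, club_in [set: T] D /\
  forall a, ord_limit_point D a -> C a = D `&` below a.

Lemma exists_gt x : exists y, (x < y)%O.
Proof.
by have [b bP] := countable_bounded (countable1 x); exists b; exact: bP.
Qed.

Lemma exists_sup (u : nat -> T) :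
  exists s, (forall n, u n <= s)%O /\ forall x, (x < s)%O -> exists n, (x < u n)%O.
Proof.
have [b bP] : exists b, forall x, range u x -> (x < b)%O.
  apply/countable_bounded/(card_le_trans (card_image_le _ _)).
  exact: countableP.
have [s sP sm] : exists2 s, (forall n, u n <= s)%O &
    forall x, (forall n, u n <= x)%O -> (s <= x)%O.
  apply: (@well_order_min [set s | forall n, u n <= s]%O).
  by exists b => n; apply/ltW/bP; exists n.
exists s; split => // x xs; apply: contrapT => H.
suff /sm : forall n, (u n <= x)%O by rewrite leNgt xs.
by move=> n; rewrite leNgt; apply/negP => xu; apply: H; exists n.
Qed.

(* Unboundedly many [C a] extending one another would form a thread. *)
Lemma no_unbounded_coherent_family (E : set T) :
  (forall x, exists2 a, E a & (x < a)%O) ->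
  ~ (forall a b, E a -> E b -> (a < b)%O -> C a = C b `&` below a).
Proof.
move=> Eunb Ecoh; apply: C_nontrivial.
pose D := \bigcup_(a in E) C a.
have DE a : E a -> D `&` below a = C a.
  move=> Ea; apply/seteqP; split=> [x [[b Eb Cbx] xa]|x Cx]; last first.
    by split; [exists a|exact: (C_club a).1.1].
  case: (ltgtP a b) => [ab|ba|ab]; last by rewrite ab.
    by rewrite (Ecoh _ _ Ea Eb ab).
  by move: Cbx; rewrite (Ecoh _ _ Eb Ea ba) => -[].
(* Through this, [D] inherits closure and coherence from the sets [C b]. *)
have limD a b : E b -> (a < b)%O -> ord_limit_point D a -> ord_limit_point (C b) a.
  move=> Eb ab [a0 limD]; split => // x /limD[y Dy /andP[xy ya]].
  exists y; last by rewrite xy.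
  by rewrite -DE //; split => //; exact: lt_trans ab.
exists D; split; last first.
  move=> a lima; have [b Eb ab] := Eunb a.
  rewrite (C_coherent (limD _ _ Eb ab lima)) -DE// -setIA; congr (_ `&` _).
  apply/seteqP; split=> [x []//|x xa]; split => //; exact: lt_trans ab.
split=> [|a _ lima]; last first.
  have [b Eb ab] := Eunb a; exists b => //.
  by apply: (C_club b).2 => //; exact: limD.
split=> // x _; have [a Ea xa] := Eunb x.
by have [y Cy xy] := (C_club a).1.2 _ xa; exists y => //; exists a.
Qed.

Lemma rho2_unbounded A n : (forall x, exists2 a, A a & (x <= a)%O) ->
  ~ (forall a b, A a -> A b -> (a < b)%O -> rho2 a b <= n).
Proof.
move=> Aunb An.
(* [good m] is weaker for larger [m] and [c]; [m] is
   taken least.  If [b] witnesses [good m c] at some [s' >= s] but [s] is not a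
   limit point of [C b], then all walks from [b] to points just below [s] start
   with the same step, to [next s b], from where they have length [< m].  By
   minimality this fails for the [s] in the unbounded set [E] below. *)
pose good m c := forall s, exists2 b, (s <= b)%O &
  forall a, A a -> (c < a < s)%O -> rho2 a b <= m.
have [x0 _] := countable_bounded (countable0 T).
have exgood : exists m, `[< exists c, good m c >].
  exists n; apply/asboolP; exists x0 => s; have [b Ab sb] := Aunb s.
  by exists b => // a Aa /andP[_ /lt_le_trans]; move=> /(_ _ sb); exact: An.
case: (ex_minnP exgood) => m /asboolP[c cm] mmin.
have m0 : 0 < m.
  rewrite lt0n; apply/eqP => m0.
  have [c' cc'] := exists_gt c.
  have [a Aa c'a] := Aunb c'; have [s sa] := exists_gt a.
  have [b sb /(_ a Aa)] := cm s.
  by rewrite (lt_le_trans cc' c'a) sa m0 rho2_lt ?(lt_le_trans sa) // => /(_ isT).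
(* Minimality of [m] refutes [good m.-1 x]. Hence every [b] from [w x] on has a walk of length at
   least [m] to a point of [A] between [x] and [w x]. *)
have /choice[w wP] x : exists y, (x < y)%O /\ forall b, (y <= b)%O ->
    exists2 a, A a /\ (x < a < y)%O & m <= rho2 a b.
  have [s sP] : exists s, forall b, (s <= b)%O ->
      exists2 a, A a /\ (x < a < s)%O & m <= rho2 a b.
    apply: contrapT => H.
    suff : m <= m.-1 by rewrite leqNgt prednK ?leqnn.
    apply: mmin; apply/asboolP; exists x => s.
    apply: contrapT => H'; apply: H; exists s => b sb.
    apply: contrapT => H; apply: H'; exists b => // a Aa xas.
    rewrite -ltnS prednK // ltnNge; apply/negP => ma.
    by apply: H; exists a.
  have [y xy] := exists_gt x.
  exists (Order.max s y); rewrite lt_max xy orbT; split=> // b.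
  rewrite ge_max => /andP[/sP[a [Aa /andP[xa sa]] ma] _].
  by exists a => //; rewrite xa lt_max sa.
pose E s := (c < s)%O /\ forall x, (x < s)%O -> forall b, (s <= b)%O ->
  exists2 a, A a /\ (x < a < s)%O & m <= rho2 a b.
apply: (@no_unbounded_coherent_family E) => [x|a b [ca aE] Eb ab].
  (* The supremum of the iterates of [w] is closed under [w] in the limit, hence belongs to [E]. *)
  pose u n := iter n w (Order.max c x).
  have [s [us sP]] := exists_sup u.
  have /andP[cs xs] : (c < s)%O && (x < s)%O.
    by rewrite -gt_max; apply: lt_le_trans (us 1); exact: (wP _).1.
  exists s => //; split => // y /sP[k yk] b sb.
  have [a [Aa /andP[ka ak]] ma] := (wP (u k)).2 b (le_trans (us k.+1) sb).
  by exists a => //; rewrite (lt_trans yk ka) (lt_le_trans ak (us k.+1)).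
(* Both [C a] and [C b] will be initial segments of [C b'], hence cohere. *)
have [b' bb' b'm] := cm b.
have lim s : E s -> (s <= b)%O -> (s < b')%O -> ord_limit_point (C b') s.
  move=> [cs sE] sb sb'; apply: contrapT => nlim.
  have [c' c's c'P] :=
    not_limit_next (ex_intro (below s) c cs) sb' nlim.
  have [_ sn _] := nextP sb'.
  have [|a0 [Aa /andP[]]] := sE (Order.max c c') _ _ sn; first by rewrite gt_max cs.
  rewrite gt_max => /andP[ca0 c'a] a0s.
  rewrite -(c'P a0) ?c'a// leqNgt -rho2_lt ?(lt_trans a0s)//.
  by rewrite b'm// ca0 (lt_le_trans a0s).
have lima : ord_limit_point (C b') a.
  by apply: lim => //; [exact: ltW|exact: lt_le_trans bb'].
rewrite (C_coherent lima).
case: (ltgtP b b') bb' => // [bb'|<-] _ //.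
rewrite (C_coherent (lim b Eb (lexx _) bb')) -setIA; congr (_ `&` _).
by apply/seteqP; split=> [x xa|x []//]; split => //; exact: lt_trans ab.
Qed.

End Walks.

(** * Bounded and unbounded subsets of a regular uncountable cardinal *)

Section RegularCardinal.
Context (d : Order.disp_t) (T : orderType d).
Hypothesis hT : regular_uncountable_cardinal T.
Implicit Types A : set T.

Lemma card_lt_bounded A : card_lt A [set: T] -> exists b, forall x, A x -> (x < b)%O.
Proof.
have [_ _ regT] := hT => Alt; apply: contrapT => H; apply: regT Alt.
split => // x _; apply: contrapT => H'; apply: H; exists x => y Ay.
by rewrite ltNge; apply/negP => xy; apply: H'; exists y.
Qed.

Lemma countable_bounded A : countable A -> exists b, forall x, A x -> (x < b)%O.
Proof.
have [_ uncT _] := hT => cA; apply: card_lt_bounded; split; first exact: card_leT.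
by move=> /card_le_trans/(_ cA).
Qed.

Lemma card_full_unbounded A : A #= [set: T] -> forall x, exists2 a, A a & (x <= a)%O.
Proof.
have [[_ ltT] _ _] := hT => AT x; apply: contrapT => H.
have [_] := ltT x; apply; rewrite -(card_le_eql AT); apply: subset_card_le => a Aa.
by rewrite /below /= ltNge; apply/negP => xa; apply: H; exists a.
Qed.

(** Otherwise the countably many bounds of the fibers would have a common bound, which would bound
    [A]. *)
Lemma unbounded_fiber A (g : T -> nat) : (forall x, exists2 a, A a & (x <= a)%O) ->
  exists n, forall x, exists2 a, A a /\ g a = n & (x <= a)%O.
Proof.
move=> Aunb; apply: contrapT => H.
have /choice[b bP] n : exists b, forall a, A a -> g a = n -> (a < b)%O.
  apply: contrapT => H'; apply: H; exists n => x.
  apply: contrapT => H; apply: H'; exists x => a Aa gan.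
  by rewrite ltNge; apply/negP => xa; apply: H; exists a.
have [|c cP] := @countable_bounded (range b).
  exact: card_le_trans (card_image_le _ _) (countableP _).
have [a Aa ca] := Aunb c.
have := lt_trans (bP _ _ Aa erefl) (cP _ (imageT b (g a))).
by rewrite ltNge ca.
Qed.

End RegularCardinal.

Theorem theorem3 (d : Order.disp_t) (T : orderType d)
    (hT : regular_uncountable_cardinal T) (hsq : square T) :
  exists X : topologicalType,
    [/\ zero_dimensional_space X,
        first_countable X,
        lt_collectionwise_hausdorff X [set: T] &
        ~ weakly_collectionwise_hausdorff X [set: T]].
Proof.
have [[woT _] _ _] := hT.
have [C [C_club C_coh C_nontriv]] := hsq.
pose f a b := if (a < b)%O then rho2 woT C_club a b else 0.
exists (pair_space f); split.
- exact: pair_space_zero_dimensional.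
- exact: pair_space_first_countable.
- move=> A dA [_ ltA].
  have [|c cP] := card_lt_bounded hT (A := @pt _ f @^-1` A).
    split; first exact: card_leT.
    by move=> /card_le_trans/(_ (card_preimage_pt _)).
  have [g gP] := rho2_dominated woT C_club C_coh c.
  (* The successor keeps the maximum above the default value 0 of [f]. *)
  apply: (@dominated_can_be_separated _ _ _ (fun a => (g a).+1)) => // a b Aa Ab _.
  rewrite /f; case: ltP => [ab|_]; last by rewrite leq_max.
  by have := gP _ _ ab (cP _ Ab); lia.
- move=> /(_ (range (@pt _ f)) (closed_discrete_range_pt f) (card_pt f setT)).
  move=> [B [B_pt B_T /can_be_separated_dominated[g gP]]].
  have [|n nP] := unbounded_fiber hT (A := @pt _ f @^-1` B) g.
    apply: card_full_unbounded => //.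
    apply: card_eq_trans (card_eq_trans B_T (card_pt f setT)).
    (* [B] has no isolated points of the space, so passing to the preimage loses no cardinality. *)
    have {2}-> : B = @pt _ f @` (@pt _ f @^-1` B).
      apply/seteqP; split=> [x Bx|]; last exact: image_preimage_subset.
      by have [a _ ax] := B_pt _ Bx; exists a; rewrite //= ax.
    by rewrite card_eq_sym; exact: card_pt.
  (* On the fiber where [g] equals [n], domination bounds all walk lengths by [n]. *)
  apply: (rho2_unbounded (woT := woT) (C_club := C_club) C_coh (countable_bounded hT)
    C_nontriv nP (n := n)).
  move=> a b [Ba ga] [Bb gb] ab.
  have := gP a b Ba Bb; rewrite /f ab ga gb maxnn => H.
  by apply/ltnW/H => eab; rewrite eab ltxx in ab.
Qed.
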